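(* Let $(M,g)$ be a Riemannian manifold and let $G$ be a Riemannian $g$-natural metric on $TM$. If $(TM,G)$ has constant sectional curvature, then $(M,g)$ is a flat Riemannian manifold.
   Context: $\mathbb{R}^+=[0,\infty)$. Let $\nabla$ be the Levi-Civita connection of $(M,g)$ and $\pi:TM\to M$ the projection. The tangent space splits as $T_{(x,u)}TM=H_{(x,u)}M\oplus V_{(x,u)}M$ into horizontal (with respect to $\nabla$) and vertical subspaces. For $X\in T_xM$, the horizontal lift $X^h\in H_{(x,u)}M$ is the unique horizontal vector with $\pi_*X^h=X$, and the vertical lift $X^v\in V_{(x,u)}M$ is the vertical vector with $X^v(df)=X(f)$ for all functions $f$ on $M$, where $df$ is viewed as the function $(x,u)\mapsto u(f)$ on $TM$. A $g$-natural metric $G$ on $TM$ is a symmetric $(0,2)$-tensor field on $TM$ obtained from $g$ by a first order natural operator; equivalently, it is given by smooth functions $\alpha_i,\beta_i:\mathbb{R}^+\to\mathbb{R}$, $i=1,2,3$ (with $\beta_i=0$ if $\dim M=1$), such that for all $x\in M$ and $u,X,Y\in T_xM$, with $t=g_x(u,u)$, $$G_{(x,u)}(X^h,Y^h)=(\alpha_1+\alpha_3)(t)g_x(X,Y)+(\beta_1+\beta_3)(t)g_x(X,u)g_x(Y,u),$$ $$G_{(x,u)}(X^h,Y^v)=G_{(x,u)}(X^v,Y^h)=\alpha_2(t)g_x(X,Y)+\beta_2(t)g_x(X,u)g_x(Y,u),$$ $$G_{(x,u)}(X^v,Y^v)=\alpha_1(t)g_x(X,Y)+\beta_1(t)g_x(X,u)g_x(Y,u).$$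 $G$ is called Riemannian if it is positive definite. Flat means that the Riemannian curvature vanishes identically. *)

(* Defs.v *)
From HB Require Import structures.
From mathcomp Require Import all_boot all_order all_algebra.
From mathcomp Require Import all_classical all_reals all_analysis.
From mathcomp Require Import lra.
Set Implicit Arguments.
Unset Strict Implicit.
Unset Printing Implicit Defensive.
Import Order.TTheory GRing.Theory Num.Theory.
Import numFieldNormedType.Exports.
Local Open Scope classical_set_scope.
Local Open Scope ring_scope.

(* Differential geometry on manifolds described by atlases of charts with values
   in the row vectors 'rV[R]_n; tensors, connections and curvature are given by
   their components in the charts. *)

Section Smooth.
Variables (R : realType) (V W : normedModType R).

(* V is meant to be finite-dimensional and U to be open. *)
Fixpoint C_on (k : nat) (U : set V) (f : V -> W) : Prop :=
  if k is k'.+1 then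
    (forall p, U p -> differentiable f p) /\
    (forall v : V, C_on k' U (fun p => 'D_v f p))
  else forall p, U p -> {for p, continuous f}.

Definition smooth_on (U : set V) (f : V -> W) : Prop := forall k, C_on k U f.

End Smooth.

(* Smoothness on the closed half-line [0, +oo[, in the usual sense for
   non-open sets: restriction of a smooth function defined on the whole line. *)
Definition smooth_on_Rplus (R : realType) (f : R -> R) : Prop :=
  exists2 F : R -> R, smooth_on setT F & forall t, 0 <= t -> F t = f t.

(* The chart of index i is [chart i] restricted to [dom i]; its values outside
   [dom i] are irrelevant. *)
Record atlas (R : realType) (M : Type) (n : nat) := Atlas {
  idx : Type;
  dom : idx -> set M;
  chart : idx -> M -> 'rV[R]_n }.

Section Manifold.
Variables (R : realType) (n : nat).

Definition chart_image (M : Type) (A : atlas R M n) (i : idx A) : set 'rV[R]_n :=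
  chart i @` dom i.

Definition overlap (M : Type) (A : atlas R M n) (i j : idx A) : set 'rV[R]_n :=
  chart i @` (dom i `&` dom j).

(* chart j \o (chart i)^-1 on [overlap i j], and 0 elsewhere *)
Definition transition (M : Type) (A : atlas R M n) (i j : idx A)
    (p : 'rV[R]_n) : 'rV[R]_n :=
  xget 0 [set q | exists x, [/\ dom i x, dom j x, chart i x = p & chart j x = q]].

Definition smooth_manifold (M : topologicalType) (A : atlas R M n) : Prop :=
  [/\ hausdorff_space M,
      @second_countable M,
      (forall x : M, exists i : idx A, dom i x),
      (* every chart is a homeomorphism between open sets *)
      (forall i : idx A,
        [/\ open (dom i),
            {in dom i &, injective (chart i)},
            (forall x, dom i x -> {for x, continuous (chart i)}) &
            (forall U : set M, open U -> U `<=` dom i -> open (chart i @` U))]) &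
      (forall i j : idx A, smooth_on (overlap i j) (transition i j))].

(* A tangent vector at x is given by its components in the charts around x,
   which are related by the Jacobian matrices of the transition maps (acting on
   row vectors).  Components in the other charts are normalized to 0, so that
   equal tangent vectors have equal components. *)
Record tangent (M : Type) (A : atlas R M n) (x : M) := Tangent {
  tcoord : idx A -> 'rV[R]_n;
  tcoordE : forall i j, dom i x -> dom j x ->
    tcoord j = tcoord i *m jacobian (transition i j) (chart i x);
  tcoord0 : forall i, ~ dom i x -> tcoord i = 0 }.

Definition tangent_bundle (M : Type) (A : atlas R M n) := {x : M & tangent A x}.

(* The chart (x, u) |-> (x^1, .., x^n, u^1, .., u^n) induced by each chart of M. *)
Definition tangent_atlas (M : Type) (A : atlas R M n) :
    atlas R (tangent_bundle A) (n + n) :=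
  @Atlas R (tangent_bundle A) (n + n) (idx A)
    (fun i z => dom i (projT1 z))
    (fun i z => row_mx (chart i (projT1 z)) (tcoord (projT2 z) i)).

(* A field of bilinear forms: [T i p] is the matrix of components, in the chart
   i, at the point of coordinates p; only p in [chart_image i] is relevant. *)
Definition bilinear_field (M : Type) (A : atlas R M n) :=
  forall i : idx A, 'rV[R]_n -> 'M[R]_n.

Definition form (B : 'M[R]_n) (X Y : 'rV[R]_n) : R := (X *m B *m Y^T) 0 0.

Definition symmetric_tensor_field (M : Type) (A : atlas R M n)
    (T : bilinear_field A) : Prop :=
  [/\ (forall i, smooth_on (chart_image i) (T i)),
      (forall i p, chart_image i p -> (T i p)^T = T i p) &
      (forall i j x, dom i x -> dom j x -> forall X Y : 'rV[R]_n,
        let J := jacobian (@transition M A i j) (chart i x) in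
        form (T i (chart i x)) X Y =
        form (T j (chart j x)) (X *m J) (Y *m J))].

Definition riemannian_metric (M : Type) (A : atlas R M n)
    (T : bilinear_field A) : Prop :=
  symmetric_tensor_field T /\
  (forall i p, chart_image i p ->
    forall X : 'rV[R]_n, X != 0 -> 0 < form (T i p) X X).

End Manifold.

(* The Levi-Civita connection and the curvature of a metric, in a chart where its
   matrix of components is the function T. *)
Section Curvature.
Variables (R : realType) (n : nat) (T : 'rV[R]_n -> 'M[R]_n).
Implicit Types (p : 'rV[R]_n) (X Y Z : 'rV[R]_n -> 'rV[R]_n).

Definition partial (a : 'I_n) (f : 'rV[R]_n -> R) p : R :=
  'D_(delta_mx 0 a) f p.

(* Christoffel symbol of the second kind, with upper index k *)
Definition christoffel (a b k : 'I_n) p : R :=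
  2^-1 * \sum_(l < n) invmx (T p) k l *
    (partial a (fun q => T q b l) p + partial b (fun q => T q a l) p
     - partial l (fun q => T q a b) p).

Definition christoffel_form p (x y : 'rV[R]_n) : 'rV[R]_n :=
  \row_(k < n) \sum_(a < n) \sum_(b < n) christoffel a b k p * x 0 a * y 0 b.

Definition nabla X Y : 'rV[R]_n -> 'rV[R]_n :=
  fun p => 'D_(X p) Y p + christoffel_form p (X p) (Y p).

Definition lie_bracket X Y : 'rV[R]_n -> 'rV[R]_n :=
  fun p => 'D_(X p) Y p - 'D_(Y p) X p.

Definition curvature_field X Y Z : 'rV[R]_n -> 'rV[R]_n :=
  fun p => nabla X (nabla Y Z) p - nabla Y (nabla X Z) p
           - nabla (lie_bracket X Y) Z p.

(* The curvature being tensorial, it is computed at p by extending the tangent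
   vectors x, y, z with constant components. *)
Definition curvature p (x y z : 'rV[R]_n) : 'rV[R]_n :=
  curvature_field (fun=> x) (fun=> y) (fun=> z) p.

Definition sectional_curvature p (x y : 'rV[R]_n) : R :=
  form (T p) (curvature p x y y) x /
  (form (T p) x x * form (T p) y y - form (T p) x y ^+ 2).

(* The two properties that characterize the Levi-Civita connection. *)

Lemma partial_tr (i j l : 'I_n) p : (\forall q \near p, (T q)^T = T q) ->
  partial l (fun q => T q i j) p = partial l (fun q => T q j i) p.
Proof.
move=> sT; apply: near_eq_derive; apply: filterS sT => q qT.
by rewrite -[in LHS]qT mxE.
Qed.

Lemma christoffel_torsion_free (a b k : 'I_n) p :
  (\forall q \near p, (T q)^T = T q) -> christoffel a b k p = christoffel b a k p.
Proof.
move=> sT; rewrite /christoffel; congr (_ * _); apply: eq_bigr => l _.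
by rewrite (partial_tr a b l sT) [in LHS](addrC (partial a _ _)).
Qed.

Lemma christoffel_metric (a b c : 'I_n) p : T p \in unitmx ->
  (\forall q \near p, (T q)^T = T q) ->
  partial c (fun q => T q a b) p =
    \sum_(k < n) (christoffel c a k p * T p k b + christoffel c b k p * T p a k).
Proof.
move=> uT sT; have sTp : (T p)^T = T p by exact: nbhs_singleton sT.
have low (i j l : 'I_n) : \sum_(k < n) christoffel i j k p * T p k l =
    2^-1 * (partial i (fun q => T q j l) p + partial j (fun q => T q i l) p
            - partial l (fun q => T q i j) p).
  pose w := \col_m (partial i (fun q => T q j m) p
     + partial j (fun q => T q i m) p - partial m (fun q => T q i j) p).
  transitivity (2^-1 * (T p *m (invmx (T p) *m w)) l 0); last first.
    by rewrite mulmxA mulmxV// mul1mx mxE.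
  rewrite mxE mulr_sumr; apply: eq_bigr => k _.
  rewrite /christoffel -mulrA; congr (_ * _); rewrite mulrC.
  rewrite -[in T p k l]sTp mxE; congr (_ * _).
  by rewrite mxE; apply: eq_bigr => m _; rewrite [w _ _]mxE.
rewrite big_split /= low.
under eq_bigr do rewrite -[in T p a _]sTp mxE.
rewrite low (partial_tr b a c sT) (partial_tr c b a sT) (partial_tr c a b sT).
by lra.
Qed.

End Curvature.

Section Geometry.
Variables (R : realType) (n : nat).

Definition flat (M : Type) (A : atlas R M n) (g : bilinear_field A) : Prop :=
  forall i p, chart_image i p ->
    forall x y z : 'rV[R]_n, curvature (g i) p x y z = 0.

(* [row_free (col_mx x y)]: x and y span a tangent plane. *)
Definition constant_sectional_curvature (M : Type) (A : atlas R M n)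
    (g : bilinear_field A) : Prop :=
  exists K : R, forall i p, chart_image i p ->
    forall x y : 'rV[R]_n, row_free (col_mx x y) ->
      sectional_curvature (g i) p x y = K.

(* Components, in the chart of the tangent bundle induced by a chart where the
   metric is g, of the lifts of X at (p, u): X^h = (X, - Gamma_p(X, u)) is the
   vector over X tangent to the curves (x, u) with u parallel along x, and
   X^v = (0, X). *)
Definition horizontal_lift (g : 'rV[R]_n -> 'M[R]_n) (p u X : 'rV[R]_n) :
    'rV[R]_(n + n) :=
  row_mx X (- christoffel_form g p X u).

Definition vertical_lift (X : 'rV[R]_n) : 'rV[R]_(n + n) := row_mx 0 X.

Definition g_natural (M : Type) (A : atlas R M n) (g : bilinear_field A)
    (G : bilinear_field (tangent_atlas A)) : Prop :=
  symmetric_tensor_field G /\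
  exists alpha1 alpha2 alpha3 beta1 beta2 beta3 : R -> R,
  [/\ [/\ smooth_on_Rplus alpha1, smooth_on_Rplus alpha2 &
          smooth_on_Rplus alpha3],
      [/\ smooth_on_Rplus beta1, smooth_on_Rplus beta2 &
          smooth_on_Rplus beta3],
      (n = 1%N -> forall t, 0 <= t -> [/\ beta1 t = 0, beta2 t = 0 & beta3 t = 0]) &
      forall (i : idx A) (p u X Y : 'rV[R]_n), chart_image i p ->
        let gp := form (g i p) in
        let Gz := form (G i (row_mx p u)) in
        let Xh := horizontal_lift (g i) p u X in
        let Yh := horizontal_lift (g i) p u Y in
        let Xv := vertical_lift X in
        let Yv := vertical_lift Y in
        let t := gp u u in
        [/\ Gz Xh Yh = (alpha1 t + alpha3 t) * gp X Y
                       + (beta1 t + beta3 t) * gp X u * gp Y u,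
            Gz Xh Yv = alpha2 t * gp X Y + beta2 t * gp X u * gp Y u,
            Gz Xv Yh = alpha2 t * gp X Y + beta2 t * gp X u * gp Y u &
            Gz Xv Yv = alpha1 t * gp X Y + beta1 t * gp X u * gp Y u]].

End Geometry.

(* Main.v *)
(* Only the zero section of TM matters.  There the Levi-Civita connection of G
   satisfies nabla_{Y^h} Z^v = (nabla_Y Z)^v, because the functions of
   t = g(u, u) that define G are critical at u = 0; hence
   R^G(X^h, Y^h) Z^v = (R(X, Y) Z)^v.  But constant curvature K means that
   R^G(X^h, Y^h) Z^v = K (G(Y^h, Z^v) X^h - G(X^h, Z^v) Y^h), which is
   horizontal.  So both sides vanish. *)
From mathcomp Require Import all_boot all_order all_algebra.
From mathcomp Require Import all_classical all_reals all_analysis.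
From mathcomp Require Import ring lra.
Require Import Defs.
Set Implicit Arguments.
Unset Strict Implicit.
Unset Printing Implicit Defensive.
Import Order.TTheory GRing.Theory Num.Theory.
Import numFieldNormedType.Exports.
Local Open Scope classical_set_scope.
Local Open Scope ring_scope.

(** The hypothesis prescribes only sectional curvatures of independent pairs, so the formula for R^G
    with three arguments has to be recovered by polarization. This rests on the symmetries of the
    curvature tensor; skewness in the last two arguments comes from the equality of mixed second
    derivatives, whence the regularity C^2 carried along. The lifts do not have constant components
    in a chart, whereas curvature is computed on fields with constant components. The computation
    therefore uses the coordinate vectors (x, 0) and (0, z): they are lifts on the zero section, and
    off it (x, 0) is X^h plus a vertical correction linear in u. That correction brings the
    Christoffel symbols of g into the first vertical derivatives of G. First order suffices, because
    the curvature in question differentiates the connection only in directions tangent to the zero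
    section. Since alpha2 may be nonzero, horizontal and vertical vectors need not be orthogonal;
    the final comparison is between components, not inner products. *)

(** * Symmetry of second derivatives *)

Section SymmetryOfSecondDerivatives.
Variables (R : realType) (V : normedModType R).
Implicit Types (f : V -> R) (p v w : V).

Lemma growth_rate_translate f c p v :
  (fun h : R => h^-1 *: (((fun q => f (q + c)) \o shift p) (h *: v) - f (p + c))) =
  (fun h => h^-1 *: ((f \o shift (p + c)) (h *: v) - f (p + c))).
Proof. by apply/funext => h /=; rewrite addrA. Qed.

Lemma derive_translate f c p v :
  'D_v (fun q => f (q + c)) p = 'D_v f (p + c).
Proof. by rewrite /derive growth_rate_translate. Qed.

Lemma derivable_translate f c p v :
  derivable f (p + c) v -> derivable (fun q => f (q + c)) p v.
Proof. by rewrite /derivable growth_rate_translate. Qed.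

Lemma is_derive_line f p v (s : R) : derivable f (p + s *: v) v ->
  is_derive s 1 (fun s => f (p + s *: v)) ('D_v f (p + s *: v)).
Proof.
have E : (fun h => h^-1 *: (((fun s => f (p + s *: v)) \o shift s) (h *: 1)
                            - f (p + s *: v))) =
         (fun h => h^-1 *: ((f \o shift (p + s *: v)) (h *: v)
                            - f (p + s *: v))).
  by apply/funext => h /=; rewrite [h%:A]mulr1 scalerDl addrCA.
by move=> df; split; rewrite /derivable /derive E.
Qed.

Lemma mean_value_line f p v (h : R) : 0 < h ->
  (forall s, 0 <= s <= h -> derivable f (p + s *: v) v) ->
  exists2 s, 0 < s < h & f (p + h *: v) - f p = 'D_v f (p + s *: v) * h.
Proof.
move=> h0 df.
have [||s] := @MVT R (fun s => f (p + s *: v))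
    (fun s => 'D_v f (p + s *: v)) 0 h h0.
- move=> s; rewrite in_itv /= => /andP[s0 sh].
  by apply: is_derive_line; apply: df; rewrite !ltW.
- apply: derivable_within_continuous => s; rewrite in_itv /= => sh.
  by have [] := is_derive_line (df s sh).
- by rewrite in_itv /= scale0r addr0 subr0 => sh E; exists s.
Qed.

(** The second difference of [f] over a parallelogram is a first difference, in direction [v], of
    [f (q + h *: w) - f q]. The mean value theorem applies to it along [v], then to ['D_v f] along
    [w]. *)
Lemma mean_value_rectangle f p v w (h : R) : 0 < h ->
  (forall s t, 0 <= s <= h -> 0 <= t <= h ->
     derivable f (p + s *: v + t *: w) v /\
     derivable ('D_v f) (p + s *: v + t *: w) w) ->
  exists s t, [/\ 0 < s < h, 0 < t < h &
    f (p + h *: v + h *: w) - f (p + h *: w) - (f (p + h *: v) - f p) =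
    'D_w ('D_v f) (p + s *: v + t *: w) * h * h].
Proof.
move=> h0 df; have h00 : 0 <= (0 : R) <= h by rewrite lexx ltW.
have hhh : 0 <= h <= h by rewrite lexx ltW.
have dfw s : 0 <= s <= h -> derivable (fun q => f (q + h *: w)) (p + s *: v) v.
  by move=> sh; apply: derivable_translate; exact: (df s h sh hhh).1.
have df0 s : 0 <= s <= h -> derivable f (p + s *: v) v.
  by move=> sh; have := (df s 0 sh h00).1; rewrite scale0r addr0.
have [s sh Es] := @mean_value_line (fun q => f (q + h *: w) - f q) p v h h0
  (fun s sh => derivableB (dfw s sh) (df0 s sh)).
have sh' : 0 <= s <= h by case/andP: sh => ? ?; rewrite !ltW.
have [t th Et] := @mean_value_line ('D_v f) (p + s *: v) w h h0
  (fun t th => (df s t sh' th).2).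
exists s, t; split=> //; rewrite -Et.
transitivity (f (p + h *: v + h *: w) - f (p + h *: v)
              - (f (p + h *: w) - f p)); first by ring.
rewrite Es; congr (_ * _); rewrite deriveB ?derive_translate//.
- exact: dfw.
- exact: df0.
Qed.

(** The second difference is symmetric in [v] and [w], so the two mixed derivatives agree at two
    points, possibly distinct, of any small parallelogram at [p]; continuity brings both values
    within [e / 2] of those at [p]. *)
Lemma derive_comm f p v w :
  (\forall q \near p, [/\ derivable f q v, derivable f q w,
     derivable ('D_v f) q w & derivable ('D_w f) q v]) ->
  {for p, continuous ('D_w ('D_v f))} -> {for p, continuous ('D_v ('D_w f))} ->
  'D_w ('D_v f) p = 'D_v ('D_w f) p.
Proof.
move=> df cwv cvw; apply/eqP; rewrite -subr_eq0 -normr_le0.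
apply/ler_addgt0Pl => e e0; rewrite addr0.
have e20 : 0 < e / 2 by rewrite divr_gt0.
have near_lt (g : V -> R) :
    {for p, continuous g} -> \forall q \near p, `|g p - g q| < e / 2.
  by move=> /cvgrPdist_lt; apply.
move: (near_lt _ cwv) (near_lt _ cvw) => {}cwv {}cvw.
have N : \forall q \near p, [/\ [/\ derivable f q v, derivable f q w,
     derivable ('D_v f) q w & derivable ('D_w f) q v],
   `|'D_w ('D_v f) p - 'D_w ('D_v f) q| < e / 2 &
   `|'D_v ('D_w f) p - 'D_v ('D_w f) q| < e / 2].
  apply: filterS3 df cwv cvw => q H1 H2 H3.
  by split; [exact: H1|exact: H2|exact: H3].
clear near_lt cwv cvw df.
have /nbhs_ballP[r /= r0 Br] := N.
(* Displacements in the parallelogram of side parameter [h] have norm at most [h * m = r / 2 < r].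
   The summand 1 keeps [m] positive when [v = w = 0]. *)
pose m := `|v| + `|w| + 1; have m0 : 0 < m by rewrite ltr_pwDr// addr_ge0.
pose h := r / 2 / m; have h0 : 0 < h by rewrite divr_gt0// divr_gt0.
have B s t : 0 <= s <= h -> 0 <= t <= h -> ball p r (p + s *: v + t *: w).
  move=> /andP[s0 sh] /andP[t0 th].
  rewrite -ball_normE /= opprD addrA opprD addrA subrr add0r -opprD normrN.
  apply: (@le_lt_trans _ _ (h * m)).
    rewrite (le_trans (ler_normD _ _))// !normrZ !ger0_norm// /m !mulrDr mulr1.
    by rewrite -[leLHS]addr0 !lerD ?ler_wpM2r// ltW.
  by rewrite /h divfK ?gt_eqF// gtr_pMr// invf_lt1// ltr1n.
have B' s t : 0 <= s <= h -> 0 <= t <= h -> ball p r (p + s *: w + t *: v).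
  by move=> sh th; rewrite addrAC; apply: B.
have [|s [t [sh th E]]] := @mean_value_rectangle f p v w h h0.
  by move=> s t sh th; have [[]] := Br _ (B _ _ sh th).
have [|s' [t' [sh' th' E']]] := @mean_value_rectangle f p w v h h0.
  by move=> s' t' sh' th'; have [[]] := Br _ (B' _ _ sh' th').
have cw x : 0 < x < h -> 0 <= x <= h by case/andP=> ? ?; rewrite !ltW.
have [_ P _] := Br _ (B _ _ (cw _ sh) (cw _ th)).
have [_ _ P'] := Br _ (B' _ _ (cw _ sh') (cw _ th')).
suff close (a b a' b' : R) : a' * h * h = b' * h * h ->
    `|a - a'| < e / 2 -> `|b - b'| < e / 2 -> `|a - b| <= e.
  apply: (close _ _ _ _ (etrans (esym E) (etrans _ E')) P P').
  by rewrite (addrAC p); ring.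
have hn0 : h != 0 by rewrite gt_eqF.
move=> /(mulIf hn0)/(mulIf hn0) -> aa' bb'; rewrite -(subrKA b').
rewrite (le_trans (ler_normD _ _))// [leRHS]splitr lerD// ?ltW//.
by rewrite distrC.
Qed.

End SymmetryOfSecondDerivatives.

(** * Differentiation of matrix-valued functions *)

Section MatrixCalculus.
Variables (R : realType) (V : normedModType R).

(** The first-order expansion of [f] is also one of [g], and uniqueness of such an expansion
    identifies the two differentials. *)
Lemma near_eq_differentiable (W : normedModType R) (f g : V -> W) p :
  {near p, f =1 g} -> differentiable f p -> differentiable g p.
Proof.
move=> fg df; have E : g \o shift p = cst (g p) + 'd f p +o_ 0 id.
  apply/eqaddoP => e e0.
  have /eqaddoP/(_ e e0) dfe := diff_locally df.
  have sfg : \forall h \near 0, f (h + p) = g (h + p).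
    by move: fg; rewrite (near_shift 0); apply: filterS => h /=; rewrite subr0.
  apply: filterS2 dfe sfg => h /= + E.
  by rewrite /cst/= !fctE/= E (nbhs_singleton fg).
have cdf : continuous ('d f p) by exact: diff_continuous.
by apply/diff_locallyP; rewrite (diff_unique cdf E).
Qed.

Lemma differentiable_coordinate m n (M : V -> 'M[R]_(m, n)) p i j :
  differentiable M p -> differentiable (fun q => M q i j) p.
Proof.
move=> dM; apply: (@differentiable_comp _ _ _ _ M (fun A => A i j)) => //.
exact: differentiable_coord.
Qed.

Lemma differentiable_mx m n (M : V -> 'M[R]_(m, n)) p :
  (forall i j, differentiable (fun q => M q i j) p) -> differentiable M p.
Proof.
move=> dM; rewrite (_ : M = \sum_i \sum_j (fun q => M q i j *: delta_mx i j)).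
  do 2!apply: differentiable_sum => ?.
  exact: differentiableZl.
apply/funext => q; rewrite [LHS]matrix_sum_delta fct_sumE.
by apply: eq_bigr => i _; rewrite fct_sumE.
Qed.

Lemma derive_coordinate m n (M : V -> 'M[R]_(m, n)) p v i j :
  derivable M p v -> 'D_v (fun q => M q i j) p = ('D_v M p) i j.
Proof. by move=> dM; rewrite derive_mx// mxE. Qed.

Lemma derivable_mulmx m n k (M : V -> 'M[R]_(m, n)) (N : V -> 'M[R]_(n, k)) p v :
  derivable M p v -> derivable N p v -> derivable (fun q => M q *m N q) p v.
Proof.
move=> /derivable_mxP dM /derivable_mxP dN; apply/derivable_mxP => i j.
rewrite (_ : (fun _ => _) = \sum_k (fun q => M q i k * N q k j)).
  by apply: derivable_sum => l; apply: derivableM.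
by apply/funext => q; rewrite mxE fct_sumE.
Qed.

Lemma derive_mulmx m n k (M : V -> 'M[R]_(m, n)) (N : V -> 'M[R]_(n, k)) p v :
  derivable M p v -> derivable N p v ->
  'D_v (fun q => M q *m N q) p = 'D_v M p *m N p + M p *m 'D_v N p.
Proof.
move=> dM dN; have [/derivable_mxP dM' /derivable_mxP dN'] := (dM, dN).
rewrite derive_mx; last exact: derivable_mulmx.
apply/matrixP => i j; rewrite !mxE -big_split/=.
rewrite (_ : (fun _ => _) = \sum_k (fun q => M q i k * N q k j)); last first.
  by apply/funext => q; rewrite mxE fct_sumE.
rewrite derive_sum; last first.
  by move=> l; exact: derivableM (dM' _ _) (dN' _ _).
apply: eq_bigr => l _; rewrite deriveM//= derive_coordinate// derive_coordinate//.
by rewrite addrC; congr (_ + _); exact: mulrC.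
Qed.

Lemma differentiable_bigprod (I : Type) (r : seq I) (F : I -> V -> R) p :
  (forall i, differentiable (F i) p) ->
  differentiable (fun q => \prod_(i <- r) F i q) p.
Proof.
move=> dF; elim: r => [|i r IH].
  by under eq_fun do rewrite big_nil; exact: differentiable_cst.
by under eq_fun do rewrite big_cons; apply: differentiableM.
Qed.

Lemma differentiable_bigsum (I : Type) (r : seq I) (F : I -> V -> R) p :
  (forall i, differentiable (F i) p) ->
  differentiable (fun q => \sum_(i <- r) F i q) p.
Proof.
move=> dF; elim: r => [|i r IH].
  by under eq_fun do rewrite big_nil; exact: differentiable_cst.
by under eq_fun do rewrite big_cons; apply: differentiableD.
Qed.

Lemma differentiable_det n (M : V -> 'M[R]_n) p :
  differentiable M p -> differentiable (fun q => \det (M q)) p.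
Proof.
move=> dM; rewrite /determinant; apply: differentiable_bigsum => s.
apply: differentiableM; first exact: differentiable_cst.
by apply: differentiable_bigprod => i; apply: differentiable_coordinate.
Qed.

(** Cramer's rule makes the inverse a rational function of the entries. It describes [invmx] only on
    invertible matrices, hence the passage through equality near [p]. *)
Lemma differentiable_invmx n (M : V -> 'M[R]_n) p :
  (\forall q \near p, M q \in unitmx) ->
  differentiable M p -> differentiable (fun q => invmx (M q)) p.
Proof.
move=> uM dM; have uMp := nbhs_singleton uM.
apply: (@near_eq_differentiable _ (fun q => (\det (M q))^-1 *: \adj (M q))).
  by apply: filterS uM => q; rewrite /invmx => ->.
apply: differentiable_mx => i j; under eq_fun do rewrite mxE.
apply: differentiableM.
  apply: differentiableV; first exact: differentiable_det.
  by move: uMp; rewrite unitmxE unitfE.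
under eq_fun do rewrite mxE /cofactor.
apply: differentiableM; first exact: differentiable_cst.
apply: differentiable_det; apply: differentiable_mx => k l.
by under eq_fun do rewrite !mxE; apply: differentiable_coordinate.
Qed.

End MatrixCalculus.

(** * Bilinear forms and their derivatives *)

Section BilinearForms.
Variables (R : realType) (n : nat).
Implicit Types (B : 'M[R]_n) (x y z : 'rV[R]_n).

Lemma formDl B x y z : form B (x + y) z = form B x z + form B y z.
Proof. by rewrite /form !mulmxDl mxE. Qed.

Lemma formDr B x y z : form B z (x + y) = form B z x + form B z y.
Proof. by rewrite /form linearD mulmxDr mxE. Qed.

Lemma formZl B (a : R) x y : form B (a *: x) y = a * form B x y.
Proof. by rewrite /form -!scalemxAl mxE. Qed.

Lemma formZr B (a : R) x y : form B x (a *: y) = a * form B x y.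
Proof. by rewrite /form linearZ -scalemxAr mxE. Qed.

Lemma formNl B x y : form B (- x) y = - form B x y.
Proof. by rewrite -scaleN1r formZl mulN1r. Qed.

Lemma formBl B x y z : form B (x - y) z = form B x z - form B y z.
Proof. by rewrite formDl formNl. Qed.

Lemma form0l B x : form B 0 x = 0.
Proof. by rewrite /form !mul0mx mxE. Qed.

Lemma form0r B x : form B x 0 = 0.
Proof. by rewrite /form trmx0 mulmx0 mxE. Qed.

Lemma formC B x y : B^T = B -> form B x y = form B y x.
Proof.
move=> sB; rewrite /form -[in LHS](trmxK (x *m B *m y^T)) mxE.
by rewrite !trmx_mul trmxK sB mulmxA.
Qed.

Lemma formDm B C x y : form (B + C) x y = form B x y + form C x y.
Proof. by rewrite /form mulmxDr mulmxDl mxE. Qed.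

Lemma formZm B (a : R) x y : form (a *: B) x y = a * form B x y.
Proof. by rewrite /form -scalemxAr -scalemxAl mxE. Qed.

Lemma form_delta B i j : form B (delta_mx 0 i) (delta_mx 0 j) = B i j.
Proof. by rewrite /form -rowE trmx_delta -colE !mxE. Qed.

Lemma row_linear_sum (f : 'rV[R]_n -> R) x :
  (forall a y z, f (a *: y + z) = a * f y + f z) ->
  f x = \sum_i x 0 i * f (delta_mx 0 i).
Proof.
move=> fP; have f0 : f 0 = 0.
  by have := fP 1 0 0; rewrite scaler0 addr0 mul1r; lra.
rewrite {1}(row_sum_delta x); elim: (index_enum _) => [|i r IH].
  by rewrite !big_nil.
by rewrite !big_cons fP IH.
Qed.

End BilinearForms.

Lemma differentiable_form (R : realType) (V : normedModType R) n
    (T : V -> 'M[R]_n) x y p :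
  differentiable T p -> differentiable (fun q => form (T q) x y) p.
Proof.
move=> dT; rewrite (_ : (fun _ => _) =
    fun q => \sum_i \sum_j x 0 i * T q i j * y 0 j).
  do 2!apply: differentiable_bigsum => ?.
  apply: differentiableM; last exact: differentiable_cst.
  apply: differentiableM; first exact: differentiable_cst.
  exact: differentiable_coordinate.
apply/funext => q; rewrite /form mxE exchange_big/=; apply: eq_bigr => j _.
by rewrite !mxE mulr_suml.
Qed.

Section FormCalculus.
Variables (R : realType) (V : normedModType R) (n : nat).
Implicit Types (T : V -> 'M[R]_n) (p v : V) (x y z : 'rV[R]_n).

Lemma derivable_form T (F : V -> 'rV[R]_n) z p v : derivable T p v ->
  derivable F p v -> derivable (fun q => form (T q) (F q) z) p v.
Proof.
move=> dT dF; have dz : derivable (cst z^T : V -> _) p v by exact: derivable_cst.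
by have /derivable_mxP := derivable_mulmx (derivable_mulmx dF dT) dz; apply.
Qed.

Lemma derive_form T (F : V -> 'rV[R]_n) z p v : derivable T p v ->
  derivable F p v ->
  'D_v (fun q => form (T q) (F q) z) p =
    form ('D_v T p) (F p) z + form (T p) ('D_v F p) z.
Proof.
move=> dT dF; have dFT := derivable_mulmx dF dT.
have dz : derivable (cst z^T : V -> _) p v by exact: derivable_cst.
rewrite (derive_coordinate 0 0 (derivable_mulmx dFT dz)).
rewrite (derive_mulmx dFT dz) (derive_mulmx dF dT) derive_cst mulmx0 addr0.
by rewrite mulmxDl mxE addrC.
Qed.

Lemma derive_form_cst T y z p v : derivable T p v ->
  'D_v (fun q => form (T q) y z) p = form ('D_v T p) y z.
Proof.
move=> dT; have dy : derivable (cst y : V -> _) p v by exact: derivable_cst.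
by rewrite (derive_form z dT dy) derive_cst form0l addr0.
Qed.

(** Openness of [U] turns equality on [U] into equality near each of its points, which is what
    derivatives see. *)
Lemma C_on_eq (W : normedModType R) k (U : set V) (f g : V -> W) :
  open U -> (forall p, U p -> f p = g p) -> C_on k U f -> C_on k U g.
Proof.
move=> oU; elim: k f g => [|k IH] f g fg /=.
  move=> cf p Up; have fgp : {near p, f =1 g}.
    by apply: filterS fg _; exact: open_nbhs_nbhs.
  move: (cf p Up) => cfp; suff : g @ p --> g p by [].
  rewrite -(fg p Up).
  by apply: cvg_trans cfp; apply: near_eq_cvg.
have fgp p : U p -> {near p, f =1 g}.
  by move=> Up; apply: filterS fg _; exact: open_nbhs_nbhs.
move=> [df Df]; split=> [p Up|v].
  exact: near_eq_differentiable (fgp p Up) (df p Up).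
apply: IH (Df v) => p Up.
by apply: near_eq_derive; exact: fgp.
Qed.

Lemma C_on_form k (U : set V) T x y : open U -> C_on k U T ->
  C_on k U (fun q => form (T q) x y).
Proof.
move=> oU; elim: k T => [|k IH] T /=.
  move=> cT p Up.
  have cf : {for T p, continuous (fun B => form B x y)}.
    apply/differentiable_continuous/(@differentiable_form _ _ _ id).
    exact: ex_diff.
  exact: continuous_comp (cT p Up) cf.
move=> [dT DT]; split=> [p Up|v]; first exact/differentiable_form/dT.
apply: C_on_eq (IH _ (DT v)) => // p Up.
by rewrite derive_form_cst//; exact/diff_derivable/dT.
Qed.

End FormCalculus.

(** A metric in a single chart, without reference to an atlas, so that the same results serve [g] in
    dimension [n] and [G] in dimension [n + n]. Two derivatives are what curvature and the
    commutation of mixed derivatives consume. *)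
Definition C2_metric_on (R : realType) (n : nat) (U : set 'rV[R]_n)
    (T : 'rV[R]_n -> 'M[R]_n) : Prop :=
  [/\ open U, C_on 2 U T, (forall p, U p -> (T p)^T = T p) &
      forall p, U p -> forall x, x != 0 -> 0 < form (T p) x x].

(** * The Levi-Civita connection through the Koszul formula *)

Section LeviCivita.
Variables (R : realType) (n : nat) (U : set 'rV[R]_n) (T : 'rV[R]_n -> 'M[R]_n).
Hypothesis metricT : C2_metric_on U T.
Implicit Types (p x y z w : 'rV[R]_n).

Lemma metric_dom_open : open U. Proof. by case: metricT. Qed.

Lemma metric_dom_near p : U p -> \forall q \near p, U q.
Proof. by move=> Up; exact: open_nbhs_nbhs (conj metric_dom_open Up). Qed.

Lemma metric_sym p : U p -> (T p)^T = T p.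
Proof. by case: metricT => _ _ sT _; exact: sT. Qed.

Lemma differentiable_metric p : U p -> differentiable T p.
Proof. by case: metricT => _ [dT _] _ _; exact: dT. Qed.

Lemma derivable_metric p v : U p -> derivable T p v.
Proof. by move=> Up; exact/diff_derivable/differentiable_metric. Qed.

Lemma metricC p x y : U p -> form (T p) x y = form (T p) y x.
Proof. by move=> Up; apply: formC; exact: metric_sym. Qed.

Lemma metric_nondegenerate p x : U p ->
  (forall w, form (T p) x w = 0) -> x = 0.
Proof.
move=> Up x0; apply/eqP/negPn/negP => xn0; case: metricT => _ _ _.
by move=> /(_ p Up x xn0); rewrite x0 ltxx.
Qed.

Lemma unit_metric p : U p -> T p \in unitmx.
Proof.
move=> Up; rewrite -row_free_unit -kermx_eq0; apply/eqP/row_matrixP => i.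
rewrite row0; apply: (metric_nondegenerate Up) => w.
by rewrite /form -row_mul mulmx_ker row0 mul0mx mxE.
Qed.

Lemma C2_metric_form x y : C_on 2 U (fun q => form (T q) x y).
Proof. by case: metricT => oU cT _ _; exact: C_on_form. Qed.

Lemma derive_metricC x y p v : U p ->
  'D_v (fun q => form (T q) x y) p = 'D_v (fun q => form (T q) y x) p.
Proof.
move=> Up; apply: near_eq_derive; apply: filterS (metric_dom_near Up) => q.
exact: metricC.
Qed.

(** Right-hand side of the Koszul formula for fields with constant components; these commute, so the
    usual bracket terms are absent. *)
Definition koszul p x y w : R :=
  2^-1 * ('D_x (fun q => form (T q) y w) p + 'D_y (fun q => form (T q) x w) p
          - 'D_w (fun q => form (T q) x y) p).

Lemma koszulE p x y w : U p -> koszul p x y w =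
  2^-1 * (form ('d T p x) y w + form ('d T p y) x w - form ('d T p w) x y).
Proof.
move=> Up; rewrite /koszul !derive_form_cst; do ?exact: derivable_metric.
by rewrite !deriveE//; exact: differentiable_metric.
Qed.

Lemma koszul_linear1 p y w : U p -> forall a x x',
  koszul p (a *: x + x') y w = a * koszul p x y w + koszul p x' y w.
Proof.
move=> Up a x x'; rewrite !koszulE// linearP.
by rewrite !(formDl, formZl, formDm, formZm); ring.
Qed.

Lemma koszul_linear2 p x w : U p -> forall a y y',
  koszul p x (a *: y + y') w = a * koszul p x y w + koszul p x y' w.
Proof.
move=> Up a y y'; rewrite !koszulE// linearP.
by rewrite !(formDl, formZl, formDm, formZm, formDr, formZr); ring.
Qed.

Lemma koszul_linear3 p x y : U p -> forall a w w',
  koszul p x y (a *: w + w') = a * koszul p x y w + koszul p x y w'.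
Proof.
move=> Up a w w'; rewrite !koszulE// linearP.
by rewrite !(formDm, formZm, formDr, formZr); ring.
Qed.

Lemma christoffel_koszul p a b k : christoffel T a b k p =
  \sum_l invmx (T p) k l * koszul p (delta_mx 0 a) (delta_mx 0 b) (delta_mx 0 l).
Proof.
have E i j : (fun q => T q i j) =
    (fun q => form (T q) (delta_mx 0 i) (delta_mx 0 j)).
  by apply/funext => q; rewrite form_delta.
rewrite /christoffel mulr_sumr; apply: eq_bigr => l _.
by rewrite /koszul /partial !E mulrCA.
Qed.

Lemma christoffel_form_koszul p x y k : U p -> christoffel_form T p x y 0 k =
  \sum_l invmx (T p) k l * koszul p x y (delta_mx 0 l).
Proof.
move=> Up; rewrite mxE.
under [RHS]eq_bigr => l _.
  rewrite (row_linear_sum x (koszul_linear1 _ _ Up)).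
  under eq_bigr => a _ do
    rewrite (row_linear_sum y (koszul_linear2 _ _ Up)).
  over.
under [LHS]eq_bigr do under eq_bigr do rewrite christoffel_koszul !mulr_suml.
under [RHS]eq_bigr do rewrite mulr_sumr.
rewrite [RHS]exchange_big/=; apply: eq_bigr => a _.
under [RHS]eq_bigr do rewrite mulrA mulr_sumr.
rewrite [RHS]exchange_big/=; apply: eq_bigr => b _.
by apply: eq_bigr => l _; ring.
Qed.

(** The Christoffel form is the covector [koszul p x y] with its index raised by [invmx (T p)];
    pairing with [T p] lowers it again. *)
Lemma koszul_formula p x y w : U p ->
  form (T p) (christoffel_form T p x y) w = koszul p x y w.
Proof.
move=> Up; rewrite (row_linear_sum w (koszul_linear3 _ _ Up)).
pose u := \row_l koszul p x y (delta_mx 0 l).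
have -> : christoffel_form T p x y = u *m invmx (T p).
  rewrite -[in invmx _](metric_sym Up) -trmx_inv.
  apply/rowP => k; rewrite christoffel_form_koszul// [RHS]mxE.
  by apply: eq_bigr => l _; rewrite !mxE mulrC.
rewrite /form mulmxKV ?unit_metric// mxE.
by apply: eq_bigr => l _; rewrite !mxE mulrC.
Qed.

(** Nondegeneracy makes the Koszul formula characterize the connection. Christoffel forms can then
    be identified without inverting a matrix, in particular the block matrix of [G]. *)
Lemma christoffel_formP p x y z : U p ->
  (forall w, form (T p) z w = koszul p x y w) -> christoffel_form T p x y = z.
Proof.
move=> Up zP; apply: subr0_eq; apply: (metric_nondegenerate Up) => w.
by rewrite formBl koszul_formula// zP subrr.
Qed.

Lemma christoffel_form_linear1 p y a x x' : U p ->
  christoffel_form T p (a *: x + x') y =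
  a *: christoffel_form T p x y + christoffel_form T p x' y.
Proof.
move=> Up; apply: (christoffel_formP Up) => w.
by rewrite koszul_linear1// formDl formZl !koszul_formula.
Qed.

Lemma christoffel_form_linear2 p x a y y' : U p ->
  christoffel_form T p x (a *: y + y') =
  a *: christoffel_form T p x y + christoffel_form T p x y'.
Proof.
move=> Up; apply: (christoffel_formP Up) => w.
by rewrite koszul_linear2// formDl formZl !koszul_formula.
Qed.

Lemma christoffel_formC p x y : U p ->
  christoffel_form T p x y = christoffel_form T p y x.
Proof.
move=> Up; apply: (christoffel_formP Up) => w.
rewrite koszul_formula// /koszul (derive_metricC y x)//.
by ring.
Qed.

Lemma derive_metric p x y z : U p -> 'D_x (fun q => form (T q) y z) p =
  form (T p) (christoffel_form T p x y) z + form (T p) y (christoffel_form T p x z).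
Proof.
move=> Up; rewrite [form _ y _]metricC// !koszul_formula// /koszul.
by rewrite (derive_metricC z y)//; field.
Qed.

Lemma differentiable_christoffel_form p x y : U p ->
  differentiable (fun q => christoffel_form T q x y) p.
Proof.
move=> Up; apply: differentiable_mx => i k; under eq_fun do rewrite mxE.
do 2!apply: differentiable_bigsum => ?.
apply: differentiableM; last exact: differentiable_cst.
apply: differentiableM; last exact: differentiable_cst.
apply: differentiableM; first exact: differentiable_cst.
apply: differentiable_bigsum => l; apply: differentiableM.
  apply/differentiable_coordinate/differentiable_invmx;
    last exact: differentiable_metric.
  by apply: filterS (metric_dom_near Up) => q; exact: unit_metric.
have dd v y' z' : differentiable ('D_v (fun q => form (T q) y' z')) p.
  by have [_ /(_ v)[dd _]] := C2_metric_form y' z'; exact: dd.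
have E i' j' : (fun q => T q i' j') =
    (fun q => form (T q) (delta_mx 0 i') (delta_mx 0 j')).
  by apply/funext => q; rewrite form_delta.
rewrite /partial !E.
apply: differentiableB; last exact: dd.
by apply: differentiableD; exact: dd.
Qed.

End LeviCivita.

(** * Algebra of curvature-like functions of four vectors *)

Section CurvatureLike.
Variables (R : realType) (V : zmodType) (F : V -> V -> V -> V -> R).
Hypotheses (F1 : forall x x' y z w, F (x + x') y z w = F x y z w + F x' y z w)
  (F2 : forall x y y' z w, F x (y + y') z w = F x y z w + F x y' z w)
  (F3 : forall x y z z' w, F x y (z + z') w = F x y z w + F x y z' w)
  (F4 : forall x y z w w', F x y z (w + w') = F x y z w + F x y z w')
  (F12 : forall x y z w, F y x z w = - F x y z w)
  (F34 : forall x y z, F x y z z = 0)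
  (bianchi : forall x y z w, F x y z w + F y z x w + F z x y w = 0)
  (sect : forall x y, F x y y x = 0).

Lemma curvature_like_skew x y z w : F x y w z = - F x y z w.
Proof. by have := F34 x y (z + w); rewrite F3 !F4 !F34; lra. Qed.

(** Up to sign, the skew symmetries reduce the twelve terms of the four rotated Bianchi identities
    to six values, each occurring twice; a linear combination leaves only the two sides. *)
Lemma curvature_like_pair x y z w : F z w x y = F x y z w.
Proof.
have sk := curvature_like_skew.
have := (bianchi x y z w, bianchi y z w x, bianchi z w x y, bianchi w x y z).
move=> [[[+ +] +] +].
rewrite (F12 x z y w) (sk y z x w) (sk z w x y) (F12 y w z x) (sk y w x z).
rewrite (F12 x w z y) (sk x w y z) (sk x z y w) (F12 x w y z) (sk x y z w).
lra.
Qed.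

(** Polarizing [sect] in its outer vector, with pair symmetry, gives [D]; polarizing [D] in the
    repeated vector gives [E], skewness in the two middle slots. The three Bianchi terms are then
    equal, so [3 * F x y z w = 0]. *)
Lemma curvature_like_eq0 x y z w : F x y z w = 0.
Proof.
have D x' y' w' : F x' y' y' w' = 0.
  have := sect (x' + w') y'; rewrite F1 !F4 !sect.
  rewrite -(curvature_like_pair w') F12 curvature_like_skew; lra.
have E x' y' z' : F x' z' y' w = - F x' y' z' w.
  by have := D x' (y' + z') w; rewrite F2 !F3 !D; lra.
have := bianchi x y z w; rewrite (E y x z) (F12 x y) (F12 x z) (E x y z); lra.
Qed.

End CurvatureLike.

(** * Symmetries of the curvature tensor *)

Section SectionalCurvature.
Variables (R : realType) (n : nat) (U : set 'rV[R]_n) (T : 'rV[R]_n -> 'M[R]_n).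
Implicit Types (p x y z w : 'rV[R]_n).

(** Constant fields commute and have zero derivative, so the bracket term drops and each inner
    [nabla] is a Christoffel form. *)
Lemma curvatureE p x y z : curvature T p x y z =
  'D_x (fun q => christoffel_form T q y z) p
  + christoffel_form T p x (christoffel_form T p y z)
  - ('D_y (fun q => christoffel_form T q x z) p
     + christoffel_form T p y (christoffel_form T p x z)).
Proof.
have N x' y' : nabla T (fun=> x') (fun=> y') =
    (fun q => christoffel_form T q x' y').
  by apply/funext => q; rewrite /nabla derive_cst add0r.
have -> : curvature T p x y z = nabla T (fun=> x) (nabla T (fun=> y) (fun=> z)) p
    - nabla T (fun=> y) (nabla T (fun=> x) (fun=> z)) p.
  rewrite /curvature /curvature_field [X in _ - X](_ : _ = 0) ?subr0//.
  rewrite /nabla /lie_bracket !derive_cst subrr add0r.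
  apply/rowP => k; rewrite !mxE big1// => a _; rewrite big1// => b _.
  by rewrite mxE mulr0 mul0r.
by rewrite !N.
Qed.

Lemma curvature_skew p x y z : curvature T p y x z = - curvature T p x y z.
Proof. by rewrite !curvatureE opprB. Qed.

Hypothesis metricT : C2_metric_on U T.

Let dchr p y z : U p -> differentiable (fun q => christoffel_form T q y z) p.
Proof. exact: differentiable_christoffel_form. Qed.

Lemma curvature_linear1 p a x x' y z : U p ->
  curvature T p (a *: x + x') y z = a *: curvature T p x y z + curvature T p x' y z.
Proof.
move=> Up; rewrite !curvatureE.
(* A directional derivative is linear in its direction once it is expressed by the differential,
   hence the use of [dchr]. *)
rewrite (deriveE (a *: x + x') (dchr y z Up)) linearP -!deriveE; [|exact: dchr..].
rewrite (christoffel_form_linear1 metricT)//.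
have E q : U q -> christoffel_form T q (a *: x + x') z =
    a *: christoffel_form T q x z + christoffel_form T q x' z.
  by move=> Uq; rewrite (christoffel_form_linear1 metricT).
rewrite E// (christoffel_form_linear2 metricT)//.
have -> : 'D_y (fun q => christoffel_form T q (a *: x + x') z) p =
    a *: 'D_y (fun q => christoffel_form T q x z) p
    + 'D_y (fun q => christoffel_form T q x' z) p.
  have dx v := @diff_derivable _ _ _ _ _ y (dchr v z Up).
  rewrite -(deriveZ a (dx x)) -(deriveD (derivableZ (k:=a) (dx x)) (dx x')).
  by apply: near_eq_derive; apply: filterS (metric_dom_near metricT Up) => q /E.
move: (christoffel_form T p) (a) => G c.
move: ('D_x _ p) ('D_x' _ p) ('D_y _ p) ('D_y _ p) => A B C D.
by apply/rowP => i; rewrite !mxE; ring.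
Qed.

Lemma curvature_linear2 p a x y y' z : U p ->
  curvature T p x (a *: y + y') z = a *: curvature T p x y z + curvature T p x y' z.
Proof.
move=> Up; rewrite (curvature_skew p (a *: y + y') x) curvature_linear1//.
by rewrite (curvature_skew p x y) (curvature_skew p x y') scalerN opprD !opprK.
Qed.

Lemma curvatureD3 p x y z z' : U p ->
  curvature T p x y (z + z') = curvature T p x y z + curvature T p x y z'.
Proof.
move=> Up; rewrite !curvatureE.
have E v q : U q -> christoffel_form T q v (z + z') =
    christoffel_form T q v z + christoffel_form T q v z'.
  move=> Uq; have := christoffel_form_linear2 metricT v 1 z z' Uq.
  by rewrite !scale1r.
have D v w : 'D_v (fun q => christoffel_form T q w (z + z')) p =
    'D_v (fun q => christoffel_form T q w z) p
    + 'D_v (fun q => christoffel_form T q w z') p.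
  have dz u := @diff_derivable _ _ _ _ _ v (dchr w u Up).
  rewrite -(deriveD (dz z) (dz z')).
  by apply: near_eq_derive; apply: filterS (metric_dom_near metricT Up) => q /E.
have L v u u' : christoffel_form T p v (u + u') =
    christoffel_form T p v u + christoffel_form T p v u'.
  by have := christoffel_form_linear2 metricT v 1 u u' Up; rewrite !scale1r.
rewrite !D !(E _ p)// !L; move: (christoffel_form T p) => G.
move: ('D_x _ p) ('D_x _ p) ('D_y _ p) ('D_y _ p) => A B C D'.
by apply/rowP => i; rewrite !mxE; ring.
Qed.

Lemma curvature_bianchi p x y z : U p ->
  curvature T p x y z + curvature T p y z x + curvature T p z x y = 0.
Proof.
move=> Up; rewrite !curvatureE.
have C v w : christoffel_form T p v w = christoffel_form T p w v.
  exact: (christoffel_formC metricT).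
have D u v w : 'D_u (fun q => christoffel_form T q v w) p =
    'D_u (fun q => christoffel_form T q w v) p.
  apply: near_eq_derive; apply: filterS (metric_dom_near metricT Up) => q.
  exact: (christoffel_formC metricT).
rewrite (D x z y) (D y x z) (D z y x) (C z y) (C x z) (C y x).
move: (christoffel_form T p) => G; move: ('D_x _ p) ('D_y _ p) ('D_z _ p) => X Y Z.
by apply/rowP => i; rewrite !mxE; ring.
Qed.

(** Metric compatibility, applied twice to [phi], shows that the commutator of ['D_x] and ['D_y] on
    [phi] is twice the left-hand side: the products of two first covariant derivatives are symmetric
    and cancel. The commutator vanishes by [derive_comm]. *)
Lemma curvature_metric p x y z : U p -> form (T p) (curvature T p x y z) z = 0.
Proof.
move=> Up; pose phi q := form (T q) z z.
have dT v : derivable T p v by exact: (derivable_metric metricT).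
have D v q : U q -> 'D_v phi q = 2 * form (T q) (christoffel_form T q v z) z.
  move=> Uq; rewrite /phi (derive_metric metricT)//.
  by rewrite [form _ z _](metricC metricT)// mulr2n mulrDl !mul1r.
have DD v w : 'D_w ('D_v phi) p = 2 *
    (form (T p) (christoffel_form T p w (christoffel_form T p v z)) z
     + form (T p) (christoffel_form T p v z) (christoffel_form T p w z)
     + form (T p) ('D_w (fun q => christoffel_form T q v z) p) z).
  have dc := @diff_derivable _ _ _ _ _ w (dchr v z Up).
  rewrite -(derive_metric metricT)// derive_form_cst//.
  rewrite -(derive_form z (dT w) dc) -deriveMl; last first.
    exact: derivable_form (dT w) dc.
  by apply: near_eq_derive; apply: filterS (metric_dom_near metricT Up) => q /D.
have [dphi cphi] : C_on 2 U phi by exact: (C2_metric_form metricT).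
have : 'D_x ('D_y phi) p = 'D_y ('D_x phi) p.
  apply: derive_comm.
  - apply: filterS (metric_dom_near metricT Up) => q Uq; split.
    + exact/diff_derivable/dphi.
    + exact/diff_derivable/dphi.
    + by have [d _] := cphi y; exact/diff_derivable/d.
    + by have [d _] := cphi x; exact/diff_derivable/d.
  - by have [_ c] := cphi y; exact: c.
  - by have [_ c] := cphi x; exact: c.
rewrite (DD y x) (DD x y) curvatureE formBl !formDl.
rewrite (metricC metricT (christoffel_form T p x z) (christoffel_form T p y z) Up).
move: (form (T p) ('D_x _ p) z) (form (T p) ('D_y _ p) z) => A B.
move: (form (T p) _ _) (form (T p) _ _) (form (T p) _ _) => C D' E.
lra.
Qed.

End SectionalCurvature.

(** * Metrics of constant sectional curvature *)

Lemma row_free_pair (R : fieldType) n (x y : 'rV[R]_n) :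
  row_free (col_mx x y) -> forall a b, a *: x + b *: y = 0 -> a = 0 /\ b = 0.
Proof.
move=> /row_free_inj fxy a b ab0.
have /eqP : row_mx a%:M b%:M = 0 :> 'rV_(1 + 1).
  by apply: fxy; rewrite mul_row_col !mul_scalar_mx mul0mx.
rewrite row_mx_eq0 => /andP[/eqP a0 /eqP b0].
by split; [have := congr1 (fun M : 'M[R]_1 => M 0 0) a0
  | have := congr1 (fun M : 'M[R]_1 => M 0 0) b0]; rewrite !mxE eqxx mulr1n.
Qed.

Lemma row_free_pairPn (R : fieldType) n (x y : 'rV[R]_n) :
  ~~ row_free (col_mx x y) -> x = 0 \/ exists c, y = c *: x.
Proof.
rewrite -kermx_eq0 => /rowV0Pn[v]; rewrite sub_kermx => /eqP.
rewrite -[v]hsubmxK; move: (lsubmx v) (rsubmx v) => a b.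
rewrite (mx11_scalar a) (mx11_scalar b) mul_row_col !mul_scalar_mx.
move: (a 0 0) (b 0 0) => {}a {}b ab0 ab.
have [b0|b0] := eqVneq b 0.
  left; apply/eqP; move/eqP: ab0; rewrite b0 scale0r addr0 scaler_eq0.
  case/orP=> [/eqP a0|//]; move: ab; rewrite a0 b0 raddf0 row_mx0 eqxx//.
right; exists (- (b^-1 * a)).
apply: (scalerI b0); rewrite scaleNr scalerN scalerA mulrA divff// mul1r.
by apply/eqP; rewrite -addr_eq0 addrC ab0.
Qed.

Section ConstantCurvature.
Variables (R : realType) (n : nat) (U : set 'rV[R]_n) (T : 'rV[R]_n -> 'M[R]_n).
Hypothesis metricT : C2_metric_on U T.
Implicit Types (p x y z w : 'rV[R]_n).

(** This licenses clearing the denominator of [sectional_curvature]. *)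
Lemma gram_neq0 p x y : U p -> row_free (col_mx x y) ->
  form (T p) x x * form (T p) y y - form (T p) x y ^+ 2 != 0.
Proof.
move=> Up fxy; have [_ _ _ /(_ p Up) pos] := metricT.
have x0 : x != 0.
  apply/eqP => x0; have [|/eqP] := @row_free_pair _ _ x y fxy 1 0; last first.
    by rewrite oner_eq0.
  by rewrite x0 scaler0 scale0r addr0.
have gx := pos x x0.
(* Up to the factor [form (T p) x x], this is the component of [y] orthogonal to [x]; its square is
   [form (T p) x x] times the Gram determinant. *)
pose z := form (T p) x x *: y + (- form (T p) x y) *: x.
have z0 : z != 0.
  apply/eqP => z0; have [_ /eqP] := @row_free_pair _ _ x y fxy (- form (T p) x y)
    (form (T p) x x) (etrans (addrC _ _) z0).
  by rewrite gt_eqF.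
have := pos z z0; rewrite /z !(formDl, formDr, formZl, formZr).
rewrite (metricC metricT y x Up) => gz.
have : 0 < form (T p) x x * (form (T p) x x * form (T p) y y - form (T p) x y ^+ 2).
  by move: gz; congr (_ < _); ring.
by rewrite pmulr_rgt0// lt0r => /andP[].
Qed.

(** Both sides have the symmetries of a curvature tensor and the same sectional values, so their
    difference [F] falls under [curvature_like_eq0]. *)
Lemma constant_curvature p (K : R) : U p ->
  (forall x y, row_free (col_mx x y) -> sectional_curvature T p x y = K) ->
  forall x y z, curvature T p x y z =
    K *: (form (T p) y z *: x - form (T p) x z *: y).
Proof.
move=> Up secK x y z.
have C := fun x y => metricC metricT x y Up.
have D1 u u' v w :
    curvature T p (u + u') v w = curvature T p u v w + curvature T p u' v w.
  by have := curvature_linear1 metricT 1 u u' v w Up; rewrite !scale1r.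
have D2 u v v' w :
    curvature T p u (v + v') w = curvature T p u v w + curvature T p u v' w.
  by have := curvature_linear2 metricT 1 u v v' w Up; rewrite !scale1r.
have D3 u v w w' :
    curvature T p u v (w + w') = curvature T p u v w + curvature T p u v w'.
  exact: (curvatureD3 metricT).
have Z2 c u v w : curvature T p u (c *: v) w = c *: curvature T p u v w.
  have R0 : curvature T p u 0 w = 0.
    by apply: (@addrI _ (curvature T p u 0 w)); rewrite -D2 !addr0.
  by have := curvature_linear2 metricT c u v 0 w Up; rewrite R0 !addr0.
have skew u v w : curvature T p v u w = - curvature T p u v w.
  exact: curvature_skew.
have bianchi u v w :
    curvature T p u v w + curvature T p v w u + curvature T p w u v = 0.
  exact: (curvature_bianchi metricT).
have skew34 u v w : form (T p) (curvature T p u v w) w = 0.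
  exact: (curvature_metric metricT).
have sec u v : row_free (col_mx u v) -> form (T p) (curvature T p u v v) u =
    K * (form (T p) u u * form (T p) v v - form (T p) u v ^+ 2).
  move=> fuv; have := secK u v fuv; rewrite /sectional_curvature => <-.
  by rewrite divfK//; exact: gram_neq0.
move: (curvature T p) D1 D2 D3 Z2 skew bianchi skew34 sec.
move=> Rm D1 D2 D3 Z2 skew bianchi skew34 sec.
pose F a b c d : R := form (T p) (Rm a b c) d -
  K * (form (T p) b c * form (T p) a d - form (T p) a c * form (T p) b d).
suff F0 : forall d, F x y z d = 0.
  apply: subr0_eq; apply: (metric_nondegenerate metricT Up) => d.
  by rewrite -[RHS](F0 d) /F !(formBl, formZl); ring.
move=> d; apply: (@curvature_like_eq0 R _ F) => {x y z d}.
- by move=> x x' y z w; rewrite /F D1 !formDl; ring.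
- by move=> x y y' z w; rewrite /F D2 !formDl; ring.
- by move=> x y z z' w; rewrite /F D3 !formDl !formDr; ring.
- by move=> x y z w w'; rewrite /F !formDr; ring.
- by move=> x y z w; rewrite /F (skew x y z) formNl; ring.
- by move=> x y z; rewrite /F skew34; ring.
- move=> x y z w; rewrite /F.
  have : form (T p) (Rm x y z) w + form (T p) (Rm y z x) w
           + form (T p) (Rm z x y) w = 0 by rewrite -!formDl bianchi form0l.
  rewrite (C z y) (C z x) (C y x) => B; rewrite -[RHS]B; ring.
- move=> x y; rewrite /F (C y x).
  (* The hypothesis covers independent pairs only; on dependent ones both the curvature term and the
     Gram determinant vanish. *)
  have [fxy|/row_free_pairPn[->|[c ->]]] := boolP (row_free (col_mx x y)).
  + by rewrite sec//; ring.
  + by rewrite !form0l !form0r; ring.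
  + have Rxx : Rm x x (c *: x) = 0.
      apply/eqP; have /eqP := skew x x (c *: x).
      by rewrite -addr_eq0 -mulr2n -scaler_nat scaler_eq0 pnatr_eq0.
    by rewrite Z2 Rxx scaler0 form0l !formZl !formZr; ring.
Qed.

End ConstantCurvature.

(** * Charts of the tangent bundle *)

Section TangentBundleCharts.
Variables (R : realType) (n : nat) (M : topologicalType) (A : atlas R M n).
Hypothesis hM : smooth_manifold A.
Implicit Types (i j k : idx A) (x : M).

Lemma open_chart (i : idx A) (U : set M) : open U -> U `<=` dom i ->
  open (chart i @` U).
Proof. by case: hM => _ _ _ /(_ i)[_ _ _ oU] _; exact: oU. Qed.

Lemma open_chart_dom i : open (dom i).
Proof. by case: hM => _ _ _ /(_ i)[]. Qed.

Lemma open_chart_image i : open (chart_image i).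
Proof. by apply: open_chart => //; exact: open_chart_dom. Qed.

(** The point chosen by [xget] has the same coordinates as [x] in the chart [i], so it is [x] by
    injectivity. *)
Lemma transitionE i j x : dom i x -> dom j x ->
  transition i j (chart i x) = chart j x.
Proof.
move=> ix jx; rewrite /transition.
have [y [iy jy xy <-]] : [set q | exists y, [/\ dom i y, dom j y,
    chart i y = chart i x & chart j y = q]]
    (xget 0 [set q | exists y, [/\ dom i y, dom j y,
    chart i y = chart i x & chart j y = q]]).
  by apply: xgetPex; exists (chart j x), x.
case: hM => _ _ _ /(_ i)[_ inj _ _] _.
by congr chart; apply: inj; rewrite ?inE.
Qed.

Lemma differentiable_transition i j x : dom i x -> dom j x ->
  differentiable (transition i j) (chart i x).
Proof.
move=> ix jx; case: hM => _ _ _ _ /(_ i j 1%N)[+ _]; apply.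
by exists x.
Qed.

Lemma near_chart i x (P : set 'rV[R]_n) (U : set M) : open U -> U `<=` dom i ->
  U x -> (forall y, U y -> P (chart i y)) -> \forall q \near chart i x, P q.
Proof.
move=> oU Ui Ux PU; have : nbhs (chart i x) (chart i @` U).
  by apply: open_nbhs_nbhs; split; [exact: open_chart|exists x].
by apply: filterS => _ [y Uy <-]; exact: PU.
Qed.

Lemma jacobian_transition_id i x : dom i x ->
  jacobian (transition i i) (chart i x) = 1%:M.
Proof.
move=> ix; apply/row_matrixP => k; rewrite [in LHS]rowE rowE mulmx1.
apply: etrans (esym (deriveEjacobian _ (differentiable_transition ix ix))) _.
rewrite -[RHS](derive_id (chart i x)); apply: near_eq_derive.
apply: (near_chart (open_chart_dom i)) => // y iy; exact: transitionE.
Qed.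

(** The chain rule, with factors in order of application because Jacobians act on row vectors. The
    transitions compose as expected only near [chart i x], which is enough. *)
Lemma jacobian_transition_comp i j k x : dom i x -> dom j x -> dom k x ->
  jacobian (transition i k) (chart i x) =
  jacobian (transition i j) (chart i x) *m jacobian (transition j k) (chart j x).
Proof.
move=> ix jx kx.
have dij := differentiable_transition ix jx.
have djk := differentiable_transition jx kx.
have djk' : differentiable (transition j k) (transition i j (chart i x)).
  by rewrite (transitionE ix jx); exact: djk.
suff chain (Jik Jij Jjk : 'M[R]_n) :
    (forall v, 'D_v (transition i k) (chart i x) = v *m Jik) ->
    (forall v, 'D_v (transition i j) (chart i x) = v *m Jij) ->
    (forall v, 'D_v (transition j k) (chart j x) = v *m Jjk) ->
    Jik = Jij *m Jjk.
  apply: chain => v.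
  - exact: (deriveEjacobian v (differentiable_transition ix kx)).
  - exact: (deriveEjacobian v dij).
  - exact: (deriveEjacobian v djk).
move=> Eik Eij Ejk; apply/row_matrixP => l.
rewrite [in LHS]rowE [in RHS]rowE mulmxA -Eik -Eij -Ejk.
transitivity ('D_(delta_mx 0 l) (transition j k \o transition i j) (chart i x)).
  apply: near_eq_derive.
  apply: (@near_chart i x _ (dom i `&` (dom j `&` dom k))).
  - by do ?apply: openI; exact: open_chart_dom.
  - by move=> y [].
  - by [].
  - by move=> y [iy [jy ky]] /=; rewrite (transitionE iy jy) !transitionE.
rewrite (deriveE _ (differentiable_comp dij djk')) (diff_comp dij djk').
by rewrite (deriveE _ djk) (deriveE _ dij) /= (transitionE ix jx).
Qed.

(** Transporting [u] to the other charts by Jacobians is consistent: the cocycle law is exactly the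
    field [tcoordE]. *)
Lemma tangent_of_coordinates i x (u : 'rV[R]_n) : dom i x ->
  exists v : tangent A x, tcoord v i = u.
Proof.
move=> ix.
pose c j := if `[< dom j x >] then u *m jacobian (transition i j) (chart i x) else 0.
have cE j k : dom j x -> dom k x ->
    c k = c j *m jacobian (transition j k) (chart j x).
  move=> jx kx; rewrite /c (asboolT jx) (asboolT kx).
  by rewrite (jacobian_transition_comp ix jx kx) mulmxA.
have c0 j : ~ dom j x -> c j = 0 by move=> jx; rewrite /c asboolF.
exists (Tangent cE c0); rewrite /= /c (asboolT ix).
by rewrite (jacobian_transition_id ix) mulmx1.
Qed.

(** Hypotheses on [G] speak of points of this image; as a full cylinder it is open and contains the
    zero section. *)
Lemma chart_image_tangent (i : idx A) :
  @chart_image R (n + n) _ (tangent_atlas A) i = [set z | chart_image i (lsubmx z)].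
Proof.
apply/seteqP; split=> [_ [z iz <-]|z [x ix xz]] /=.
  by rewrite row_mxKl; exists (projT1 z).
have [v vz] := tangent_of_coordinates (rsubmx z) ix.
exists (existT _ x v) => //=.
by rewrite vz xz hsubmxK.
Qed.

End TangentBundleCharts.

(** * First-order expansions along the fibres *)

Lemma christoffel_form0r (R : realType) n (T : 'rV[R]_n -> 'M[R]_n) p x :
  christoffel_form T p x 0 = 0.
Proof.
apply/rowP => k; rewrite !mxE big1// => a _; rewrite big1// => b _.
by rewrite mxE mulr0.
Qed.

(** The inner function has a critical point at 0. The chain rule is applied to the extension [F],
    since 0 is an end point of the half-line where [f] is controlled; the argument [s ^+ 2 * m]
    never leaves it. *)
Lemma is_derive_smooth_square (R : realType) (f : R -> R) (m : R) :
  smooth_on_Rplus f -> 0 <= m ->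
  is_derive (0 : R) (1 : R) (fun s => f (s ^+ 2 * m)) 0.
Proof.
move=> [F sF Ff] m0.
have -> : (fun s => f (s ^+ 2 * m)) = F \o (fun s => s ^+ 2 * m).
  by apply/funext => s /=; rewrite Ff// mulr_ge0// sqr_ge0.
have dF x : derivable F x 1 by apply: diff_derivable; have [+ _] := sF 1%N; apply.
have [dq q'] : is_derive (0 : R) (1 : R) (fun s : R => s ^+ 2 * m) 0.
  have : is_derive (0 : R) (1 : R) ((@id R) ^+ 2 * cst m)
    ((id 0 ^+ 2) *: 0 + m *: ((2%:R *: id 0 ^+ 1) *: 1)).
    exact: is_deriveM.
  by rewrite /= expr0n !scaler0 scale0r scaler0 addr0.
split; last first.
  by rewrite -derive1E (derive1_comp dq (dF _)) [X in _ * X]derive1E q' mulr0.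
apply/derivable1_diffP/differentiable_comp.
  exact: ((derivable1_diffP _ _).1 dq).
exact: ((derivable1_diffP _ _).1 (dF _)).
Qed.

(** The shape of a component of [G] along a line [(p, s *: z)] in a fibre: a critical coefficient, a
    linear term, and a remainder of order two. *)
Lemma derive_second_order (R : realType) (c0 c1 E : R -> R) (a b : R) :
  is_derive (0 : R) (1 : R) c0 0 -> derivable c1 0 1 -> derivable E 0 1 ->
  'D_1 (fun s => c0 s * a + c1 s * (b * s) + E s * s ^+ 2) 0 = c1 0 * b.
Proof.
move=> dc0 /derivableP dc1 /derivableP dE.
have did := is_derive_id (0 : R) (1 : R).
have dA := is_deriveM dc0 (is_derive_cst a (0 : R) (1 : R)).
have dB := is_deriveM dc1 (is_deriveM (is_derive_cst b (0 : R) (1 : R)) did).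
have [_ D] := is_deriveD (is_deriveD dA dB) (is_deriveM dE (is_deriveM did did)).
apply: etrans D _.
transitivity (c0 0 * 0 + a * 0 + (c1 0 * (b * 1 + 0 * 0) + (b * 0) * 'D_1 c1 0)
  + (E 0 * (0 * 1 + 0 * 1) + 0 * 0 * 'D_1 E 0)); first by [].
by ring.
Qed.

Section TangentDerivatives.
Variables (R : realType) (n : nat) (W : normedModType R).
Variable (f : 'rV[R]_(n + n) -> W).

Lemma growth_rate_row_mxl p u x :
  (fun h : R => h^-1 *: ((f \o shift (row_mx p u)) (h *: row_mx x 0)
                           - f (row_mx p u))) =
  (fun h => h^-1 *: (((fun q => f (row_mx q u)) \o shift p) (h *: x)
                    - f (row_mx p u))).
Proof. by apply/funext => h /=; rewrite scale_row_mx add_row_mx scaler0 add0r. Qed.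

Lemma derive_row_mxl p u x :
  'D_(row_mx x 0) f (row_mx p u) = 'D_x (fun q => f (row_mx q u)) p.
Proof. by rewrite /derive growth_rate_row_mxl. Qed.

Lemma derive_row_mxr p z :
  'D_(row_mx 0 z) f (row_mx p 0) = 'D_1 (fun s : R => f (row_mx p (s *: z))) 0.
Proof.
rewrite /derive; have -> : (fun h : R => h^-1 *:
      ((f \o shift (row_mx p 0)) (h *: row_mx 0 z) - f (row_mx p 0))) =
    (fun h => h^-1 *: (((fun s => f (row_mx p (s *: z))) \o shift 0) (h *: 1)
                       - f (row_mx p (0 *: z)))).
  apply/funext => h /=; rewrite scale_row_mx add_row_mx scaler0 add0r addr0.
  by rewrite addr0 scale0r [h%:A]mulr1.
by [].
Qed.

End TangentDerivatives.

(** * Connection and curvature of [G] along the zero section *)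

Section ZeroSection.
Variables (R : realType) (n : nat) (U : set 'rV[R]_n).
Variables (g : 'rV[R]_n -> 'M[R]_n) (G : 'rV[R]_(n + n) -> 'M[R]_(n + n)).
Variables (alpha1 alpha2 alpha3 beta1 beta2 beta3 : R -> R).
Hypotheses (metricg : C2_metric_on U g)
  (metricG : C2_metric_on [set z | U (lsubmx z)] G).
Hypotheses (salpha1 : smooth_on_Rplus alpha1) (salpha2 : smooth_on_Rplus alpha2)
  (salpha3 : smooth_on_Rplus alpha3) (sbeta1 : smooth_on_Rplus beta1)
  (sbeta2 : smooth_on_Rplus beta2) (sbeta3 : smooth_on_Rplus beta3).
Implicit Types (p u x y z w : 'rV[R]_n).

Hypothesis natural : forall p u x y, U p ->
  let gp := form (g p) in
  let Gz := form (G (row_mx p u)) in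
  let xh := horizontal_lift g p u x in
  let yh := horizontal_lift g p u y in
  let xv := vertical_lift x in
  let yv := vertical_lift y in
  let t := gp u u in
  [/\ Gz xh yh = (alpha1 t + alpha3 t) * gp x y
                 + (beta1 t + beta3 t) * gp x u * gp y u,
      Gz xh yv = alpha2 t * gp x y + beta2 t * gp x u * gp y u,
      Gz xv yh = alpha2 t * gp x y + beta2 t * gp x u * gp y u &
      Gz xv yv = alpha1 t * gp x y + beta1 t * gp x u * gp y u].

(** Lets [natural], stated on lifts, evaluate [G] on vectors with constant components. *)
Lemma row_mx_lift p u x : row_mx x 0 =
  horizontal_lift g p u x + vertical_lift (christoffel_form g p x u).
Proof. by rewrite /horizontal_lift /vertical_lift add_row_mx addr0 addNr. Qed.

Lemma zero_section_vv p x y : U p ->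
  form (G (row_mx p 0)) (row_mx 0 x) (row_mx 0 y) = alpha1 0 * form (g p) x y.
Proof.
move=> Up; have [_ _ _] := natural 0 x y Up.
by rewrite /vertical_lift !form0r mulr0 addr0.
Qed.

Lemma zero_section_hv p x y : U p ->
  form (G (row_mx p 0)) (row_mx x 0) (row_mx 0 y) = alpha2 0 * form (g p) x y.
Proof.
move=> Up; have [_ + _ _] := natural 0 x y Up.
by rewrite /horizontal_lift christoffel_form0r oppr0 !form0r mulr0 addr0.
Qed.

Let chrZ p x (s : R) z : U p ->
  christoffel_form g p x (s *: z) = s *: christoffel_form g p x z.
Proof.
move=> Up; have := christoffel_form_linear2 metricg x s z 0 Up.
by rewrite christoffel_form0r !addr0.
Qed.

Lemma metric_ge0 p z : U p -> 0 <= form (g p) z z.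
Proof.
move=> Up; have [->|z0] := eqVneq z 0; first by rewrite form0r.
by case: metricg => _ _ _ /(_ p Up z z0)/ltW.
Qed.

Let dcoef (f : R -> R) p z : smooth_on_Rplus f -> U p ->
  is_derive (0 : R) (1 : R) (fun s => f (s ^+ 2 * form (g p) z z)) 0.
Proof. by move=> sf Up; apply: is_derive_smooth_square => //; exact: metric_ge0. Qed.

(** At [u = s *: z] the vertical correction of [row_mx x 0] is [s] times [christoffel_form g p x z];
    its pairing with [row_mx 0 y] through [alpha1] is the only contribution of first order in
    [s]. *)
Lemma derive_vertical_hv p x y z : U p ->
  'D_(row_mx 0 z) (fun q => form (G q) (row_mx x 0) (row_mx 0 y)) (row_mx p 0) =
  alpha1 0 * form (g p) (christoffel_form g p x z) y.
Proof.
move=> Up; rewrite derive_row_mxr.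
pose m := form (g p) z z; pose c := christoffel_form g p x z.
(* The [beta] terms contain two factors linear in [u], hence [s ^+ 2]; the vertical correction adds
   one more [s] to the [beta1] term. *)
pose E s := beta2 (s ^+ 2 * m) * (form (g p) x z * form (g p) y z)
  + beta1 (s ^+ 2 * m) * (form (g p) c z * form (g p) y z * s).
have -> : (fun s : R => form (G (row_mx p (s *: z))) (row_mx x 0) (row_mx 0 y)) =
    (fun s => alpha2 (s ^+ 2 * m) * form (g p) x y
     + alpha1 (s ^+ 2 * m) * (form (g p) c y * s) + E s * s ^+ 2).
  apply/funext => s; rewrite (row_mx_lift p (s *: z)) formDl -/(vertical_lift y).
  have [_ -> _ _] := natural (s *: z) x y Up.
  have [_ _ _ ->] := natural (s *: z) (christoffel_form g p x (s *: z)) y Up.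
  rewrite chrZ// !(formZl, formZr) -/c -/m mulrA -expr2 /E; ring.
rewrite (derive_second_order _ _ (dcoef z salpha2 Up)).
- by rewrite expr0n /= mul0r.
- by have [] := dcoef z salpha1 Up.
- apply: derivableD; apply: derivableM.
  + by have [] := dcoef z sbeta2 Up.
  + exact: derivable_cst.
  + by have [] := dcoef z sbeta1 Up.
  + by apply: derivableM; [exact: derivable_cst|exact: derivable_id].
Qed.

(** Here the first-order part consists of the two cross pairings of a horizontal lift with the
    correction of the other vector, both weighted by [alpha2]. *)
Lemma derive_vertical_hh p x y z : U p ->
  'D_(row_mx 0 z) (fun q => form (G q) (row_mx x 0) (row_mx y 0)) (row_mx p 0) =
  alpha2 0 * (form (g p) x (christoffel_form g p y z)
              + form (g p) (christoffel_form g p x z) y).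
Proof.
move=> Up; rewrite derive_row_mxr.
pose m := form (g p) z z.
pose c := christoffel_form g p x z; pose d := christoffel_form g p y z.
pose E s := (beta1 (s ^+ 2 * m) + beta3 (s ^+ 2 * m))
    * (form (g p) x z * form (g p) y z)
  + beta2 (s ^+ 2 * m)
    * ((form (g p) x z * form (g p) d z + form (g p) c z * form (g p) y z) * s)
  + (alpha1 (s ^+ 2 * m) * form (g p) c d
     + beta1 (s ^+ 2 * m) * ((form (g p) c z * form (g p) d z) * (s * s))).
have -> : (fun s : R => form (G (row_mx p (s *: z))) (row_mx x 0) (row_mx y 0)) =
    (fun s => (alpha1 (s ^+ 2 * m) + alpha3 (s ^+ 2 * m)) * form (g p) x y
     + alpha2 (s ^+ 2 * m) * ((form (g p) x d + form (g p) c y) * s) + E s * s ^+ 2).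
  apply/funext => s; rewrite 2!(row_mx_lift p (s *: z)) !formDl !formDr.
  have [-> _ _ _] := natural (s *: z) x y Up.
  have [_ -> _ _] := natural (s *: z) x (christoffel_form g p y (s *: z)) Up.
  have [_ _ -> _] := natural (s *: z) (christoffel_form g p x (s *: z)) y Up.
  have [_ _ _ ->] := natural (s *: z) (christoffel_form g p x (s *: z))
    (christoffel_form g p y (s *: z)) Up.
  rewrite !chrZ// !(formZl, formZr) -/c -/d -/m mulrA -expr2 /E; ring.
have [a1 _] := dcoef z salpha1 Up; have [a2 _] := dcoef z salpha2 Up.
have [b1 _] := dcoef z sbeta1 Up; have [b2 _] := dcoef z sbeta2 Up.
have [b3 _] := dcoef z sbeta3 Up.
have d13 : is_derive (0 : R) (1 : R)
    (fun s => alpha1 (s ^+ 2 * m) + alpha3 (s ^+ 2 * m)) (0 + 0).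
  exact: is_deriveD (dcoef z salpha1 Up) (dcoef z salpha3 Up).
rewrite addr0 in d13; rewrite (derive_second_order _ _ d13).
- by rewrite expr0n /= mul0r.
- exact: a2.
- have cst1 (a : R) : derivable (cst a : R -> R) 0 1 by exact: derivable_cst.
  have id1 : derivable (@id R) 0 1 by exact: derivable_id.
  apply: derivableD; first apply: derivableD.
  + exact: derivableM (derivableD b1 b3) (cst1 _).
  + exact: derivableM b2 (derivableM (cst1 _) id1).
  + apply: derivableD; first exact: derivableM a1 (cst1 _).
    exact: derivableM b1 (derivableM (cst1 _) (derivableM id1 id1)).
Qed.

Lemma derive_horizontal_vv p x y z : U p ->
  'D_(row_mx x 0) (fun q => form (G q) (row_mx 0 y) (row_mx 0 z)) (row_mx p 0) =
  alpha1 0 * 'D_x (fun q => form (g q) y z) p.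
Proof.
move=> Up; rewrite derive_row_mxl -deriveMl; last first.
  exact/diff_derivable/differentiable_form/(differentiable_metric metricg).
apply: near_eq_derive; apply: filterS (metric_dom_near metricg Up) => q Uq.
exact: zero_section_vv.
Qed.

Lemma derive_horizontal_hv p x y z : U p ->
  'D_(row_mx x 0) (fun q => form (G q) (row_mx y 0) (row_mx 0 z)) (row_mx p 0) =
  alpha2 0 * 'D_x (fun q => form (g q) y z) p.
Proof.
move=> Up; rewrite derive_row_mxl -deriveMl; last first.
  exact/diff_derivable/differentiable_form/(differentiable_metric metricg).
apply: near_eq_derive; apply: filterS (metric_dom_near metricg Up) => q Uq.
exact: zero_section_hv.
Qed.

Lemma christoffel_zero_section p y z : U p ->
  christoffel_form G (row_mx p 0) (row_mx y 0) (row_mx 0 z) =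
  row_mx 0 (christoffel_form g p y z).
Proof.
move=> Up; have UG : U (lsubmx (row_mx p (0 : 'rV[R]_n))) by rewrite row_mxKl.
have gC v w := metricC metricg v w Up.
have GC a b v := derive_metricC metricG a b v UG.
apply: (christoffel_formP metricG UG) => w.
rewrite -[w]hsubmxK -[lsubmx w]addr0 -[rsubmx w]add0r -add_row_mx.
move: (lsubmx w) (rsubmx w) => {}w w'; rewrite formDr.
rewrite -[row_mx w 0]scale1r (koszul_linear3 metricG)// scale1r mul1r.
congr (_ + _).
  (* Test against [row_mx w 0]: all terms carry [alpha2 0], and compatibility and symmetry of the
     connection of [g] reduce them to the claim. *)
  rewrite (metricC metricG)// zero_section_hv// /koszul.
  rewrite (GC (row_mx 0 z) (row_mx w 0)).
  rewrite !derive_horizontal_hv// derive_vertical_hh// !(derive_metric metricg)//.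
  rewrite (gC (christoffel_form g p y z) w) (christoffel_formC metricg w y Up).
  by field.
(* Test against [row_mx 0 w']: all terms carry [alpha1 0], and the two vertical derivatives complete
   the horizontal one to twice the claim. *)
rewrite zero_section_vv// /koszul derive_horizontal_vv//.
rewrite !derive_vertical_hv// (derive_metric metricg)//.
by rewrite (gC z); field.
Qed.

(** Directions [row_mx x 0] and [row_mx y 0] are tangent to the zero section, so
    [christoffel_zero_section] can be differentiated there. Its values are again of the form
    [row_mx 0 _], so it can also be iterated. *)
Lemma curvature_zero_section p x y z : U p ->
  curvature G (row_mx p 0) (row_mx x 0) (row_mx y 0) (row_mx 0 z) =
  row_mx 0 (curvature g p x y z).
Proof.
move=> Up; rewrite !curvatureE !christoffel_zero_section//.
have D v w :
    'D_(row_mx v 0) (fun q => christoffel_form G q (row_mx w 0) (row_mx 0 z))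
      (row_mx p 0) = row_mx 0 ('D_v (fun q => christoffel_form g q w z) p).
  have dw := @diff_derivable _ _ _ _ _ v
    (differentiable_christoffel_form metricg w z Up).
  (* Right multiplication by this constant matrix is the embedding [row_mx 0], which the product
     rule thus moves out of the derivative. *)
  have d1 : derivable (cst (row_mx 0 1%:M : 'M[R]_(n, n + n)) : 'rV[R]_n -> _) p v.
    exact: derivable_cst.
  have := derive_mulmx dw d1.
  rewrite derive_cst mulmx0 addr0 /= mul_mx_row mulmx0 mulmx1.
  move=> <-; rewrite derive_row_mxl; apply: near_eq_derive.
  apply: filterS (metric_dom_near metricg Up) => q Uq.
  by rewrite christoffel_zero_section// mul_mx_row mulmx0 mulmx1.
rewrite (D x) (D y) !add_row_mx opp_row_mx add_row_mx.
by rewrite addr0 oppr0 addr0.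
Qed.

End ZeroSection.

Theorem proposition4p2 (R : realType) (n : nat) (M : topologicalType)
    (A : atlas R M n) (hM : smooth_manifold A)
    (g : bilinear_field A) (hg : riemannian_metric g)
    (G : bilinear_field (tangent_atlas A))
    (hnat : g_natural g G) (hG : riemannian_metric G)
    (hK : constant_sectional_curvature G) :
  flat g.
Proof.
move=> i p ip x y z.
have metricg : C2_metric_on (chart_image i) (g i).
  have [[sg symg _] posg] := hg.
  by split; [exact: open_chart_image|exact: sg|exact: symg|exact: posg].
have metricG : C2_metric_on [set z | chart_image i (lsubmx z)] (G i).
  have [[sG symG _] posG] := hG.
  rewrite -(chart_image_tangent hM).
  split; [|exact: sG|exact: symG|exact: posG].
  rewrite (chart_image_tangent hM).
  apply: (@open_comp _ _ lsubmx); last exact: open_chart_image.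
  by move=> q _; exact: continuous_lsubmx.
have [_ [a1 [a2 [a3 [b1 [b2 [b3 [[sa1 sa2 sa3] [sb1 sb2 sb3] _ nat]]]]]]]] := hnat.
have [K secK] := hK.
have ip0 : chart_image i (lsubmx (row_mx p (0 : 'rV[R]_n))) by rewrite row_mxKl.
have secK0 v w : row_free (col_mx v w) ->
    sectional_curvature (G i) (row_mx p 0) v w = K.
  by apply: secK; rewrite (chart_image_tangent hM).
have := constant_curvature metricG ip0 secK0 (row_mx x 0) (row_mx y 0) (row_mx 0 z).
rewrite (curvature_zero_section metricg metricG sa1 sa2 sa3 sb1 sb2 sb3
  (nat i))//.
(* Only the second halves are compared; there the values of [G] and [K] multiply zero vectors. *)
rewrite !scale_row_mx opp_row_mx add_row_mx scale_row_mx => /eq_row_mx[_ ->].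
by rewrite !scaler0 subr0 scaler0.
Qed.
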